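(* Let $q\geq 2$ be an integer, let $(X,\mathcal{B}_X,\mu,T)$ be a $\mathbb{Z}^q$-MPS and let $\alpha$ be a finite measurable partition of $X$. If there exists an infinite subset $S$ of $\mathbb{Z}^q$ such that $h^S_\mu(T,\alpha)>0$, then there are at most $q-1$ linearly independent directions $\vec{v}=(1,\beta_2,\ldots,\beta_q)\in\mathbb{R}^q$ with $h_\mu^{\vec{v},*}(\alpha)=0$; that is, any linearly independent set of directions of the form $(1,\beta_2,\ldots,\beta_q)\in\mathbb{R}^q$, each satisfying $h_\mu^{\vec{v},*}(\alpha)=0$, has at most $q-1$ elements.
   Context: A $\mathbb{Z}^q$-measure preserving dynamical system ($\mathbb{Z}^q$-MPS) is a quadruple $(X,\mathcal{B}_X,\mu,T)$ where $X$ is a compact metric space, $\mathcal{B}_X$ its Borel $\sigma$-algebra, $T$ assigns to each $\vec{w}\in\mathbb{Z}^q$ a homeomorphism $T^{\vec{w}}:X\to X$ with $T^{\vec{w}}\circ T^{\vec{u}}=T^{\vec{w}+\vec{u}}$ and $T^{\vec{0}}=\mathrm{id}_X$, and $\mu$ is a Borel probability measure on $X$ invariant under every $T^{\vec{w}}$. For $\vec{v}=(1,\beta_2,\ldots,\beta_q)\in\mathbb{R}^q$ and $\mathbf{b}=(b_2,\ldots,b_q)\in\mathbb{R}^{q-1}_+$ (all $b_i>0$), put $$\Lambda^{\vec{v}}(\mathbf{b})=\{(m_1,\ldots,m_q)\in\mathbb{Z}^q:\beta_i m_1-b_i/2\leq m_i\leq\beta_i m_1+b_i/2,\ i=2,\ldots,q\}.$$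 For a finite measurable partition $\alpha$, $H_\mu(\alpha)=-\sum_{A\in\alpha}\mu(A)\log\mu(A)$ (with $0\log 0=0$). An infinite subset $S=\{\vec{w}_i\}_{i=1}^\infty$ of $\mathbb{Z}^q$ is understood to come with an enumeration as a sequence of pairwise distinct elements; put $$h^S_\mu(T,\alpha)=\limsup_{k\to\infty}\frac1k H_\mu\left(\bigvee_{i=1}^k T^{-\vec{w}_i}\alpha\right).$$ Define $h_\mu^{\vec{v},*}(\alpha)=\max_{S\subset\Lambda^{\vec{v}}(\mathbf{b})}h^S_\mu(T,\alpha)$, over all infinite subsets $S$ of $\Lambda^{\vec{v}}(\mathbf{b})$; the maximum is attained (so it equals the supremum) and does not depend on the choice of $\mathbf{b}\in\mathbb{R}^{q-1}_+$. *)

(* Defs.v *)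
From HB Require Import structures.
From mathcomp Require Import all_boot all_order all_algebra.
From mathcomp Require Import all_classical all_reals all_analysis.

Set Implicit Arguments.
Unset Strict Implicit.
Unset Printing Implicit Defensive.

Import Order.TTheory GRing.Theory Num.Theory.
Import numFieldNormedType.Exports.

Local Open Scope classical_set_scope.
Local Open Scope ring_scope.

(* Throughout, q = p.+1: Z^q is 'rV[int]_p.+1 and R^q is 'rV[R]_p.+1. The first
   coordinate has index ord0, the coordinates 2, ..., q have indices
   lift ord0 i with i : 'I_p. *)

(* measurableType inherits from pointedType, so the metric space carries a base
   point; a space with a probability measure is nonempty anyway. *)
#[short(type="pointedMetricType")]
HB.structure Definition PointedMetric (R : numDomainType) :=
  {X of Pointed X & Metric R X}.

Notation borel X := (g_sigma_algebraType (@open X)).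

Definition homeomorphism (X Y : topologicalType) (f : X -> Y) : Prop :=
  continuous f /\
  exists g : Y -> X, [/\ continuous g, cancel f g & cancel g f].

Record is_Zq_mps (R : realType) (p : nat) (X : pointedMetricType R)
    (mu : probability (borel X) R) (T : 'rV[int]_p.+1 -> X -> X) : Prop := {
  mps_compact : compact [set: X];
  mps_homeo : forall w, homeomorphism (T w);
  mps_comp : forall w u, T w \o T u = T (w + u);
  mps_id : T 0 = id;
  mps_invariant : forall w (A : set (borel X)),
    measurable A -> mu (T w @^-1` A) = mu A }.

(* A finite family of pairwise disjoint measurable sets covering the space.
   Empty cells are allowed; they do not contribute to any entropy. *)
Record measurable_partition d (X : measurableType d) (I : finType)
    (alpha : I -> set X) : Prop := {
  mpart_measurable : forall i, measurable (alpha i);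
  mpart_disjoint : trivIset [set: I] alpha;
  mpart_cover : \bigcup_i alpha i = [set: X] }.

(* The convention 0 log 0 = 0 holds because the product with 0 is 0. *)
Definition entropy d (X : measurableType d) (R : realType)
    (mu : probability X R) (I : finType) (alpha : I -> set X) : R :=
  - \sum_i fine (mu (alpha i)) * ln (fine (mu (alpha i))).

(* The join of T^{-w_1} alpha, ..., T^{-w_k} alpha, where w_{j+1} is w j. Its
   cells are indexed by {ffun 'I_k -> I}; T^{-w} A is the preimage of A by T^w,
   which is also its image by T^(-w). *)
Definition join_along (X W : Type) (T : W -> X -> X) (w : nat -> W)
    (I : finType) (alpha : I -> set X) (k : nat) (f : {ffun 'I_k -> I}) :
    set X :=
  \bigcap_(j in [set: 'I_k]) (T (w j) @^-1` alpha (f j)).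

(* h^S_mu(T, alpha) for S = {w 0, w 1, ...}. The term k = 0 is irrelevant. *)
Definition seq_entropy (R : realType) (p : nat) (X : pointedMetricType R)
    (mu : probability (borel X) R) (T : 'rV[int]_p.+1 -> X -> X)
    (I : finType) (alpha : I -> set (borel X)) (w : nat -> 'rV[int]_p.+1) :
    \bar R :=
  limn_esup (fun k : nat =>
    (k%:R^-1 * entropy mu (@join_along (borel X) _ T w I alpha k))%:E).

Definition is_direction (R : realType) (p : nat) (v : 'rV[R]_p.+1) : Prop :=
  v ord0 ord0 = 1.

(* For a direction v, beta_i is the coordinate v 0 (lift ord0 i). *)
Definition Lambda (R : realType) (p : nat) (v : 'rV[R]_p.+1) (b : 'rV[R]_p) :
    set 'rV[int]_p.+1 :=
  [set m | forall i : 'I_p,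
    v ord0 (lift ord0 i) * (m ord0 ord0)%:~R - b ord0 i / 2
      <= (m ord0 (lift ord0 i))%:~R
      <= v ord0 (lift ord0 i) * (m ord0 ord0)%:~R + b ord0 i / 2].

(* An infinite subset with an enumeration by pairwise distinct elements is an
   injective sequence, so the supremum is over all injective sequences in
   Lambda v b. It is attained, and does not depend on the positive vector b. *)
Definition dir_entropy (R : realType) (p : nat) (X : pointedMetricType R)
    (mu : probability (borel X) R) (T : 'rV[int]_p.+1 -> X -> X)
    (I : finType) (alpha : I -> set (borel X))
    (b : 'rV[R]_p) (v : 'rV[R]_p.+1) : \bar R :=
  ereal_sup [set seq_entropy mu T alpha w | w in
    [set w : nat -> 'rV[int]_p.+1 | injective w /\ range w `<=` Lambda v b]].

(* Main.v *)
Require Import Defs.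
From HB Require Import structures.
From mathcomp Require Import all_boot all_order all_algebra.
From mathcomp Require Import all_classical all_reals all_analysis.
From mathcomp Require Import lra zify.
Set Implicit Arguments.
Unset Strict Implicit.
Unset Printing Implicit Defensive.
Import Order.TTheory GRing.Theory Num.Theory.
Import numFieldNormedType.Exports.
Local Open Scope classical_set_scope.
Local Open Scope ring_scope.

(** Fix the partition alpha and put
    d(u, v) = mu (the points that T^u and T^v send to different cells of alpha).
    This is a pseudometric on Z^q, invariant under translations because mu is
    invariant under T. The proof links entropy along sequences to total
    boundedness for d.

    Entropy and prediction. Let c and e be finite-valued measurable functions
    and let err be the smallest probability of error when e is predicted by a
    function of c. The conditional entropy H(e | c) is at least err
    ([mispredict_le_ent]) and tends to 0 with err, at a rate that depends only
    on the number of values of e ([ent_le_mispredict]).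

    Zero directional entropy makes Lambda totally bounded
    ([dir_entropy0_totally_bounded]). If for some eps > 0 every finite join of
    translates of alpha left some T^{-u} alpha, u in Lambda, with conditional
    entropy at least eps, choosing such u one after the other would give a
    sequence in Lambda of entropy at least eps. So for every eps a single finite
    join predicts all T^{-u} alpha, u in Lambda, up to error eps. There are
    finitely many prediction rules on that join, and two elements of Lambda with
    the same rule are at distance less than 2 eps.

    Directions add up ([near_span_totally_bounded]). As d is translation
    invariant, a sum of totally bounded sets is totally bounded. The strip
    Lambda of a direction v contains lattice points at bounded distance from
    every point of the line R v ([Lambda_relatively_dense]), however small b is.
    So the lattice points at bounded distance from the span of directions of
    zero entropy form a totally bounded set. If q of these directions were
    independent, this set would be Z^q.

    A totally bounded Z^q has no entropy ([totally_bounded_seq_entropy]). Along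
    any sequence, every late term is d-close to an earlier one, so its
    translate of alpha is almost determined by the past, and the entropies of
    the joins grow sublinearly. This contradicts the hypothesis on S. *)

(** * Entropy of a finite distribution *)

Section RealInequalities.
Context {R : realType}.

(** The pointwise form of Gibbs' inequality, from ln x <= x - 1 at
    x = q M / m. Here m is the mass of a cell inside a set of mass M, and q is
    any guess of m / M; summing over cells bounds an entropy by the length of the
    code with weights q. *)
Lemma gibbs_term (m M q : R) : 0 <= m -> m <= M -> 0 < q ->
  m * (ln M - ln m) <= q * M - m - m * ln q.
Proof.
move=> m0 mM q0; have [->|mn0] := eqVneq m 0.
  by rewrite !mul0r !subr0 (mulr_ge0 (ltW q0) (le_trans m0 mM)).
have mp : 0 < m by rewrite lt_neqAle eq_sym mn0.
have Mp : 0 < M by apply: lt_le_trans mM.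
have xp : 0 < q * M / m by rewrite divr_gt0 ?mulr_gt0.
have := @le_ln1Dx R (q * M / m - 1).
rewrite ltrBrDr addNr addrC subrK => /(_ xp).
rewrite ln_div ?posrE ?mulr_gt0 // lnM ?posrE // => h.
have := ler_wpM2l m0 h.
have -> : m * (q * M / m - 1) = q * M - m.
  by rewrite mulrBr mulr1 mulrCA divff ?mulr1.
nra.
Qed.

(** Take for k the most probable value. Since - ln x >= 1 - x, each term is at
    least m i * (1 - m i / M), hence at least m i * (1 - m k / M), and these sum
    to M - m k. *)
Lemma cond_entropy_ge (I : finType) (m : I -> R) (i0 : I) :
  (forall i, 0 <= m i) ->
  exists k, \sum_(i | i != k) m i
    <= \sum_i m i * (ln (\sum_i m i) - ln (m i)).
Proof.
move=> m0; set M := \sum_i m i.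
have mM i : m i <= M by rewrite /M (bigD1 i) //= lerDl sumr_ge0.
exists [arg max_(i > i0) m i]%O; case: arg_maxP => // k _ kmax.
have M0 : 0 <= M by apply: le_trans (mM k).
have eM : M = m k + \sum_(i | i != k) m i by rewrite /M (bigD1 k).
have -> : \sum_(i | i != k) m i = M - m k by rewrite eM addrC addKr.
have [MZ|Mn0] := eqVneq M 0.
  have mZ i : m i = 0 by apply/eqP; rewrite eq_le m0 -MZ mM.
  by rewrite MZ mZ subr0 big1 // => i _; rewrite mZ mul0r.
(* Spread M - m k over the values in proportion to their masses. *)
have -> : M - m k = \sum_i m i * (1 - m k / M).
  by rewrite -mulr_suml -/M mulrBr mulr1 mulrCA divff ?mulr1.
apply: ler_sum => i _.
have [->|min0] := eqVneq (m i) 0; first by rewrite !mul0r.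
have mip : 0 < m i by rewrite lt_neqAle eq_sym min0 m0.
have Mp : 0 < M by rewrite lt_neqAle eq_sym Mn0.
apply: ler_wpM2l => //.
have := @le_ln1Dx R (m i / M - 1).
rewrite ltrBrDr addNr addrC subrK => /(_ (divr_gt0 mip Mp)).
rewrite ln_div ?posrE // => h.
have : m i / M <= m k / M by rewrite ler_pM2r ?invr_gt0 //; apply: kmax.
lra.
Qed.

(** Gibbs' inequality for the weights 1 at the predicted value k and t at the
    others. The weights are not normalized; their excess over 1 is at most
    #|I| * t, which gives the first term. *)
Lemma cond_entropy_le (I : finType) (m : I -> R) (k : I) (t : R) :
  (forall i, 0 <= m i) -> 0 < t ->
  \sum_i m i * (ln (\sum_i m i) - ln (m i))
    <= #|I|%:R * t * (\sum_i m i) - (\sum_(i | i != k) m i) * ln t.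
Proof.
move=> m0 t0; set M := \sum_i m i.
have mM i : m i <= M by rewrite /M (bigD1 i) //= lerDl sumr_ge0.
have M0 : 0 <= M by apply: le_trans (mM k).
have eM : M = m k + \sum_(i | i != k) m i by rewrite /M (bigD1 k).
rewrite (bigD1 k) //=.
have := gibbs_term (m0 k) (mM k) ltr01; rewrite ln1 mulr0 subr0 mul1r => hk.
have : \sum_(i | i != k) m i * (ln M - ln (m i)) <=
  \sum_(i | i != k) (t * M - m i - m i * ln t).
  by apply: ler_sum => i _; apply: gibbs_term.
rewrite 2!sumrB -[X in _ <= _ - X]mulr_suml sumr_const.
set err := \sum_(i | i != k) m i in eM *.
have : (t * M) *+ #|[pred i | i != k]| <= #|I|%:R * t * M.
  rewrite -mulr_natl mulrA; apply: ler_wpM2r => //.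
  apply: ler_wpM2r; first exact: ltW.
  by rewrite ler_nat max_card.
lra.
Qed.

End RealInequalities.

(** * Finite-valued random variables: conditional entropy and prediction *)

Section FiniteVariables.
Context d (X : measurableType d) (R : realType) (mu : probability X R).

Definition fin_var (J : finType) (c : X -> J) :=
  forall j, measurable (c @^-1` [set j]).

Definition pr (A : set X) : R := fine (mu A).

Definition ent (J : finType) (c : X -> J) : R :=
  entropy mu (fun j => c @^-1` [set j]).

Lemma fin_var_comp (J K : finType) (c : X -> J) (g : J -> K) :
  fin_var c -> fin_var (g \o c).
Proof.
move=> mc k; have -> : (g \o c) @^-1` [set k] =
    \bigcup_(j in g @^-1` [set k]) c @^-1` [set j].
  by apply/seteqP; split => x /= => [h|[j /= <- <-]] //; exists (c x).
by apply: fin_bigcup_measurable => // j _; apply: mc.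
Qed.

Lemma fin_var_pair (J K : finType) (c : X -> J) (e : X -> K) :
  fin_var c -> fin_var e -> fin_var (fun x => (c x, e x)).
Proof.
move=> mc me [j k]; rewrite (_ : _ @^-1` _ =
  c @^-1` [set j] `&` e @^-1` [set k]); first exact: measurableI.
by apply/seteqP; split => x /= [-> ->].
Qed.

Lemma fin_var_ffun (J K : finType) (c : J -> X -> K) :
  (forall j, fin_var (c j)) -> fin_var (fun x => [ffun j => c j x]).
Proof.
move=> mc f; rewrite (_ : _ @^-1` _ =
  \bigcap_(j in [set: J]) c j @^-1` [set f j]).
  by apply: fin_bigcap_measurable => // j _; apply: mc.
apply/seteqP; split => x /=; first by move=> <- j _ /=; rewrite ffunE.
by move=> h; apply/ffunP => j; rewrite ffunE; apply: h.
Qed.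

Lemma fin_var_event (J : finType) (c : X -> J) (P : set J) :
  fin_var c -> measurable (c @^-1` P).
Proof.
move=> mc; rewrite (_ : _ @^-1` _ = \bigcup_(j in P) c @^-1` [set j]).
  by apply: fin_bigcup_measurable => // j _; apply: mc.
by apply/seteqP; split => x /= => [h|[j /= + ->]] //; exists (c x).
Qed.

Lemma pr_ge0 A : 0 <= pr A.
Proof. exact: fine_ge0. Qed.

Lemma prT : pr setT = 1.
Proof. by rewrite /pr probability_setT. Qed.

Lemma pr_le (A B : set X) : measurable A -> measurable B -> A `<=` B ->
  pr A <= pr B.
Proof.
move=> mA mB AB; rewrite /pr fine_le ?fin_num_measure //.
by apply: le_measure; rewrite ?inE.
Qed.

Lemma pr_leU (A B C : set X) : measurable A -> measurable B -> measurable C ->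
  A `<=` B `|` C -> pr A <= pr B + pr C.
Proof.
move=> mA mB mC ABC; have mBC : measurable (B `|` C) by apply: measurableU.
apply: (le_trans (pr_le mA mBC ABC)).
rewrite /pr -fineD ?fin_num_measure // fine_le ?fin_numD ?fin_num_measure //.
exact: measureU2.
Qed.

Lemma pr_event (J : finType) (c : X -> J) (P : pred J) : fin_var c ->
  pr [set x | P (c x)] = \sum_(j | P j) pr (c @^-1` [set j]).
Proof.
move=> mc.
have -> : [set x | P (c x)] = \bigcup_(j in [set` enum P]) c @^-1` [set j].
  apply/seteqP; split => x /= => [h|[j /=]].
    by exists (c x); rewrite //= mem_enum.
  by rewrite mem_enum => + ->.
rewrite /pr measure_fin_bigcup //; last by move=> i j _ _ [x /= [<- <-]].
rewrite -fsbig_seq ?enum_uniq // -sum_fine ?big_enum // => j _.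
by apply: fin_num_measure; apply: mc.
Qed.

Lemma pr_fiber (J K : finType) (c : X -> J) (e : X -> K) j :
  fin_var c -> fin_var e ->
  pr (c @^-1` [set j]) = \sum_k pr ((fun x => (c x, e x)) @^-1` [set (j, k)]).
Proof.
move=> mc me; have mce := fin_var_pair mc me.
rewrite (_ : _ @^-1` _ = [set x | (c x, e x).1 == j]); last first.
  by apply/seteqP; split => x /= /eqP.
rewrite (pr_event (fun z => z.1 == j) mce).
set m := fun a b => pr ((fun x => (c x, e x)) @^-1` [set (a, b)]).
transitivity (\sum_(z | (z.1 == j) && true) m z.1 z.2).
  by apply: eq_big => [[a b]|[a b]] //=; rewrite andbT.
by rewrite -(pair_big_dep (eq_op^~ j) (fun _ => xpredT) m) big_pred1_eq.
Qed.

(** The chain rule: the left-hand side is the conditional entropy of e given c,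
    the right-hand side sums over the cells of c. *)
Lemma ent_incr (J K : finType) (c : X -> J) (e : X -> K) :
  fin_var c -> fin_var e ->
  let m j k := pr ((fun x => (c x, e x)) @^-1` [set (j, k)]) in
  ent (fun x => (c x, e x)) - ent c =
    \sum_j \sum_k m j k * (ln (\sum_k m j k) - ln (m j k)).
Proof.
move=> mc me m; rewrite /ent /entropy opprK addrC.
have -> : \sum_j fine (mu (c @^-1` [set j])) * ln (fine (mu (c @^-1` [set j])))
    = \sum_j \sum_k m j k * ln (\sum_k m j k).
  by apply: eq_bigr => j _; rewrite -/(pr _) (pr_fiber j mc me) -mulr_suml.
rewrite (eq_bigr (fun z : J * K => m z.1 z.2 * ln (m z.1 z.2))); last by case.
rewrite -(pair_big xpredT xpredT (fun j k => m j k * ln (m j k))) /= -sumrB.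
apply: eq_bigr => j _; rewrite -sumrB; apply: eq_bigr => k _.
by rewrite mulrBr.
Qed.

Lemma pr_mispredict (J K : finType) (c : X -> J) (e : X -> K) (phi : J -> K) :
  fin_var c -> fin_var e ->
  pr [set x | phi (c x) != e x] =
    \sum_j \sum_(k | k != phi j) pr ((fun x => (c x, e x)) @^-1` [set (j, k)]).
Proof.
move=> mc me; have mce := fin_var_pair mc me.
rewrite (pr_event (fun z => phi z.1 != z.2) mce).
rewrite pair_big_dep /=; apply: eq_big => [[j k]|[j k] _] //=.
by rewrite eq_sym.
Qed.

(** The predictor phi sends each value of c to the most probable value of e
    given it. *)
Lemma mispredict_le_ent (J K : finType) (c : X -> J) (e : X -> K) (k0 : K) :
  fin_var c -> fin_var e ->
  exists phi : J -> K,
    pr [set x | phi (c x) != e x] <= ent (fun x => (c x, e x)) - ent c.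
Proof.
move=> mc me; set m := fun j k => pr ((fun x => (c x, e x)) @^-1` [set (j, k)]).
have /choice [phi hphi] : forall j, exists k, \sum_(i | i != k) m j i
    <= \sum_i m j i * (ln (\sum_i m j i) - ln (m j i)).
  by move=> j; apply: (cond_entropy_ge k0) => k; apply: pr_ge0.
exists phi; rewrite pr_mispredict // ent_incr //.
by apply: ler_sum => j _; apply: hphi.
Qed.

(** A Fano-type bound. For t small and then the error probability small compared
    with 1 / |ln t|, the right-hand side is as small as desired. *)
Lemma ent_le_mispredict (J K : finType) (c : X -> J) (e : X -> K)
    (phi : J -> K) (t : R) :
  fin_var c -> fin_var e -> 0 < t ->
  ent (fun x => (c x, e x)) - ent c
    <= #|K|%:R * t - pr [set x | phi (c x) != e x] * ln t.
Proof.
move=> mc me t0; rewrite pr_mispredict // ent_incr //.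
set m := fun j k => pr ((fun x => (c x, e x)) @^-1` [set (j, k)]).
have -> : #|K|%:R * t = \sum_j #|K|%:R * t * \sum_k m j k.
  rewrite -mulr_sumr (eq_bigr (fun j => pr (c @^-1` [set j]))).
    rewrite -(pr_event xpredT mc) (_ : [set x | _] = setT) ?prT ?mulr1 //.
    by apply/seteqP; split.
  by move=> j _; rewrite (pr_fiber j mc me).
rewrite mulr_suml -sumrB; apply: ler_sum => j _.
by apply: cond_entropy_le => // k; apply: pr_ge0.
Qed.

(** Entropy depends only on the partition into fibers, not on the labels. *)
Lemma ent_inj (J K : finType) (c : X -> J) (g : J -> K) (g' : K -> J) :
  cancel g g' -> cancel g' g -> ent (g \o c) = ent c.
Proof.
move=> gK g'K; rewrite /ent /entropy; congr (- _).
rewrite (reindex g) /=; last by exists g' => x _.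
apply: eq_bigr => j _; rewrite (_ : _ @^-1` _ = c @^-1` [set j]) //.
by apply/seteqP; split => x /= => [/(can_inj gK)|->].
Qed.

Lemma ent_ge0 (J : finType) (c : X -> J) : fin_var c -> 0 <= ent c.
Proof.
move=> mc; rewrite /ent /entropy -sumrN sumr_ge0 // => j _.
rewrite -mulrN mulr_ge0 ?fine_ge0 // oppr_ge0 ln_le0 //.
by rewrite -prT; apply: pr_le.
Qed.

End FiniteVariables.

(** * Finite colourings *)

(** The pigeonhole behind the finite nets for Lambda and behind the bounded gaps
    of its lattice points. *)
Lemma color_representatives (A : choiceType) (M : set A) (C : finType)
    (color : A -> C) :
  exists2 F : seq A, (forall f, f \in F -> M f) &
    forall a, M a -> exists2 f, f \in F & color f = color a.
Proof.
have /choice [g hg] : forall col, exists o : option A,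
    (forall f, o = Some f -> M f) /\
    forall a, M a -> color a = col -> exists2 f, o = Some f & color f = col.
  move=> col; have [[f [Mf cf]]|h] := pselect (exists f, M f /\ color f = col).
    by exists (Some f); split=> [_ [<-]|a _ _] //; exists f.
  by exists None; split=> // a Ma ca; case: h; exists a.
exists (pmap g (enum C)) => [f|a Ma].
  by rewrite mem_pmap => /mapP [col _ /esym]; apply: (hg col).1.
have [f gf cf] := (hg (color a)).2 a Ma erefl.
by exists f => //; rewrite mem_pmap; apply/mapP; exists (color a); rewrite ?mem_enum.
Qed.

(** * Families of random variables and total boundedness *)

Section Process.
Context d (X : measurableType d) (R : realType) (mu : probability X R).
Context (W : choiceType) (I : finType) (c : W -> X -> I).
Hypothesis mc : forall w, fin_var (c w).

Definition history (w : nat -> W) (k : nat) (x : X) : {ffun 'I_k -> I} :=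
  [ffun j : 'I_k => c (w j) x].

(** The conditional entropy of c u given the first k terms along w. *)
Definition innovation (w : nat -> W) (k : nat) (u : W) : R :=
  ent mu (fun x => (history w k x, c u x)) - ent mu (history w k).

(** This vanishes when c u and c v agree almost surely, so it is only a
    pseudometric. *)
Definition dist (u v : W) : R := pr mu [set x | c u x != c v x].

Definition totally_bounded (M : set W) : Prop :=
  forall e, 0 < e -> exists F : seq W,
    forall u, M u -> exists2 f, f \in F & dist u f < e.

Lemma fin_var_history w k : fin_var (history w k).
Proof. by apply: fin_var_ffun => j; apply: mc. Qed.

Lemma eq_history (w w' : nat -> W) k : (forall j, (j < k)%N -> w j = w' j) ->
  history w k = history w' k.
Proof.
by move=> h; apply/funext => x; apply/ffunP => j; rewrite !ffunE h.
Qed.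

Lemma ent_historyS w k :
  ent mu (history w k.+1) = ent mu (history w k) + innovation w k (w k).
Proof.
rewrite /innovation addrC subrK.
pose g (f : {ffun 'I_k.+1 -> I}) := ([ffun j => f (lift ord_max j)], f ord_max).
pose g' (z : {ffun 'I_k -> I} * I) : {ffun 'I_k.+1 -> I} :=
  [ffun j => if unlift ord_max j is Some j' then z.1 j' else z.2].
rewrite -(@ent_inj _ _ _ mu _ _ (history w k.+1) g g').
- congr (ent mu _); apply/funext => x; rewrite /g /=; congr (_, _).
    by apply/ffunP => j; rewrite !ffunE lift_max.
  by rewrite ffunE.
- move=> f; apply/ffunP => j; rewrite ffunE /=.
  by case: unliftP => [j' ->|->]; rewrite ?ffunE.
- move=> [f i]; rewrite /g; congr (_, _); last by rewrite ffunE unlift_none.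
  by apply/ffunP => j; rewrite !ffunE liftK.
Qed.

Lemma measurable_neq (J : finType) (a b : X -> J) : fin_var a -> fin_var b ->
  measurable [set x | a x != b x].
Proof.
move=> ma mb.
exact: (fin_var_event [set z : J * J | z.1 != z.2] (fin_var_pair ma mb)).
Qed.

Lemma dist0 u : dist u u = 0.
Proof.
rewrite /dist (_ : [set x | _] = set0); first by rewrite /pr measure0.
by apply/seteqP; split => x //=; rewrite eqxx.
Qed.

Lemma dist_sym u v : dist u v = dist v u.
Proof.
by congr (pr mu _); apply/funext => x /=; rewrite eq_sym.
Qed.

Lemma dist_triangle v u w : dist u w <= dist u v + dist v w.
Proof.
apply: pr_leU; try exact: measurable_neq.
move=> x /= uw; have [uv|] := eqVneq (c u x) (c v x); last by left.
by right; rewrite -uv.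
Qed.

Lemma totally_bounded_finite (F : seq W) (M : set W) :
  (forall u, M u -> u \in F) -> totally_bounded M.
Proof. by move=> MF e e0; exists F => u /MF uF; exists u; rewrite ?dist0. Qed.

(** When w k is close to an earlier w j, the j-th entry of the history is a good
    predictor of c (w k). *)
Lemma innovation_small e : 0 < e -> exists2 r, 0 < r &
  forall w k j, (j < k)%N -> dist (w j) (w k) < r -> innovation w k (w k) <= e.
Proof.
move=> e0.
(* In ent_le_mispredict, t is chosen to make the first term at most e / 2, and
   then r to make the second term at most e / 2. *)
pose t : R := e / (2 * (#|I|%:R + 1)).
have n0 : 0 <= #|I|%:R :> R by [].
have n1 : 0 < 2 * (#|I|%:R + 1) :> R by lra.
have t0 : 0 < t by rewrite divr_gt0.
have tI : #|I|%:R * t <= e / 2.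
  have : t * (2 * (#|I|%:R + 1)) = e by rewrite mulfVK // gt_eqF.
  by lra.
have l0 : 0 < 2 * (`|ln t| + 1) :> R by have := normr_ge0 (ln t); lra.
exists (e / (2 * (`|ln t| + 1))); first by rewrite divr_gt0.
move=> w k j jk; rewrite /dist => dj.
have := @ent_le_mispredict _ _ _ mu _ _ (history w k) (c (w k))
  (fun f => f (Ordinal jk)) t (@fin_var_history w k) (mc (w k)) t0.
rewrite -/(innovation _ _ _); set err := pr mu _ => h.
have errE : err < e / (2 * (`|ln t| + 1)).
  by rewrite /err; under eq_set do rewrite ffunE.
have : err * (2 * (`|ln t| + 1)) <= e by rewrite -ler_pdivlMr // ltW.
have err0 : 0 <= err by apply: pr_ge0.
have : - (err * ln t) <= err * `|ln t|.
  by rewrite -mulrN ler_wpM2l // -normrN ler_norm.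
lra.
Qed.

(** From some K on each term adds at most e / 2 to the entropy, and the entropy
    of the first K terms is absorbed by the division by k. *)
Lemma recurrent_entropy_rate w :
  (forall e, 0 < e -> exists K, forall k, (K <= k)%N ->
    exists2 j, (j < k)%N & dist (w j) (w k) < e) ->
  forall e, 0 < e -> exists K, forall k, (K <= k)%N ->
    k%:R^-1 * ent mu (history w k) <= e.
Proof.
move=> rec e e0; have e20 : 0 < e / 2 by lra.
have [r /rec [K hK] hr] := innovation_small e20.
have step n : ent mu (history w (K + n)) <= ent mu (history w K) + n%:R * (e / 2).
  elim: n => [|n IH]; first by rewrite addn0 mul0r addr0.
  rewrite addnS ent_historyS -natr1.
  have [j jk dj] := hK (K + n)%N (leq_addr _ _).
  have := hr _ _ _ jk dj; lra.
have E0 := ent_ge0 mu (@fin_var_history w K).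
exists (maxn K.+1 (Num.truncn (ent mu (history w K) / (e / 2))).+1) => k.
rewrite geq_max => /andP [Kk tk].
have k0 : 0 < k%:R :> R by rewrite ltr0n (leq_trans _ Kk).
rewrite mulrC ler_pdivrMr //.
have := step (k - K)%N; rewrite subnKC ?(ltnW Kk) //.
have : (k - K)%:R <= k%:R :> R by rewrite ler_nat leq_subr.
have : ent mu (history w K) < k%:R * (e / 2).
  rewrite -ltr_pdivrMr //; apply: (@lt_le_trans _ _ _); first exact: truncnS_gt.
  by rewrite ler_nat.
nra.
Qed.

(** Every ball of a finite cover that w ever visits has been visited before some
    time K. *)
Lemma totally_bounded_recurrent w : totally_bounded setT ->
  forall e, 0 < e -> exists K, forall k, (K <= k)%N ->
    exists2 j, (j < k)%N & dist (w j) (w k) < e.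
Proof.
move=> tb e e0; have /tb [F hF] : 0 < e / 2 by lra.
have /choice [g hg] : forall f, exists n, forall k, dist (w k) f < e / 2 ->
    exists2 j, (j < n)%N & dist (w j) f < e / 2.
  move=> f; have [[k hk]|h] := pselect (exists k, dist (w k) f < e / 2).
    by exists k.+1 => _ _; exists k.
  by exists 0%N => k hk; case: h; exists k.
exists (\max_(f <- F) g f)%N => k Kk.
have [f fF df] := hF (w k) Logic.I.
have [j jn dj] := hg f k df; exists j.
  by apply: leq_trans jn (leq_trans _ Kk); apply: leq_bigmax_seq.
have := dist_triangle f (w j) (w k); rewrite [dist f _]dist_sym; lra.
Qed.

(** The recursion builds the lists L k of the first k terms; completing L k to an
    infinite sequence in any way gives the same history of length k. *)
Lemma greedy_sequence (w0 : W) (M : set W) (e : R) :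
  (forall w k, (forall j, (j < k)%N -> M (w j)) ->
    exists2 u, M u & e <= innovation w k u) ->
  exists2 w, (forall k, M (w k)) & forall k, e <= innovation w k (w k).
Proof.
move=> h.
have /choice [g hg] : forall z : (nat -> W) * nat, exists u,
    (forall j, (j < z.2)%N -> M (z.1 j)) -> M u /\ e <= innovation z.1 z.2 u.
  move=> [w k] /=.
  have [/h [u Mu hu]|nh] := pselect (forall j, (j < k)%N -> M (w j)).
    by exists u.
  by exists w0.
pose L := fix L k :=
  if k is k'.+1 then rcons (L k') (g (nth w0 (L k'), k')) else [::].
pose w k := g (nth w0 (L k), k).
have sL k : size (L k) = k by elim: k => //= k IH; rewrite size_rcons IH.
have nL k j : (j < k)%N -> nth w0 (L k) j = w j.
  elim: k => // k IH; rewrite ltnS leq_eqVlt /= nth_rcons sL => /orP[/eqP ->|jk].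
    by rewrite ltnn eqxx.
  by rewrite jk IH.
have Mw k : M (w k).
  elim/ltn_ind: k => k IH; apply: (hg (nth w0 (L k), k) _).1 => j jk /=.
  by rewrite nL //; apply: IH.
exists w => // k.
have ML j : (j < k)%N -> M (nth w0 (L k) j) by move=> jk; rewrite nL.
have := (hg (nth w0 (L k), k) ML).2.
by rewrite /innovation (@eq_history _ w) //; apply: nL.
Qed.

(** A repeated term is a function of the history, so its innovation is 0. *)
Lemma innovating_inj w e : 0 < e -> (forall k, e <= innovation w k (w k)) ->
  injective w.
Proof.
move=> e0 h; have e20 : 0 < e / 2 by lra.
have [r r0 hr] := innovation_small e20.
have ne j k : (j < k)%N -> w j <> w k.
  move=> jk wE; have := hr w k j jk; rewrite -{1}wE dist0 => /(_ r0).
  by have := h k; lra.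
by move=> j k wE; case: (ltngtP j k) => // [/ne|/ne] []; rewrite wE.
Qed.

Lemma innovating_entropy w e : (forall k, e <= innovation w k (w k)) ->
  forall k, (0 < k)%N -> e <= k%:R^-1 * ent mu (history w k).
Proof.
move=> h k k0; rewrite mulrC ler_pdivlMr ?ltr0n // mulrC.
elim: k {k0} => [|k IH]; first by rewrite mul0r ent_ge0 //; apply: fin_var_history.
by rewrite ent_historyS -natr1 mulrDl mul1r lerD.
Qed.

(** One history predicts all the c u, u in M, and only finitely many prediction
    rules exist. If u and f share a rule phi, then c u and c f can differ only
    where phi errs for u or for f. *)
Lemma predictable_totally_bounded (i0 : I) (M : set W) :
  (forall e, 0 < e -> exists w k, forall u, M u -> innovation w k u < e) ->
  totally_bounded M.
Proof.
move=> h e e0; have /h [w [k hk]] : 0 < e / 2 by lra.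
have /choice [phi hphi] : forall u, exists phi : {ffun {ffun 'I_k -> I} -> I},
    M u -> pr mu [set x | phi (history w k x) != c u x] < e / 2.
  move=> u; have [Mu|nMu] := pselect (M u); last by exists [ffun=> i0].
  have [phi hphi] := mispredict_le_ent mu i0 (@fin_var_history w k) (mc u).
  exists [ffun f => phi f] => _; under eq_set do rewrite ffunE.
  exact: le_lt_trans hphi (hk u Mu).
have [F FM hF] := color_representatives M phi.
exists F => u Mu; have [f fF phif] := hF u Mu; exists f => //.
have mphi v : measurable [set x | phi v (history w k x) != c v x].
  apply: measurable_neq => //.
  by apply: (@fin_var_comp _ _ _ _ (history w k) (phi v)); apply: fin_var_history.
apply: (@le_lt_trans _ _ (pr mu [set x | phi u (history w k x) != c u x] +
  pr mu [set x | phi f (history w k x) != c f x])).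
  apply: pr_leU => //; first exact: measurable_neq.
  move=> x /= uf; have [E|] := eqVneq (phi u (history w k x)) (c u x); last by left.
  by right; rewrite phif E.
by have := hphi u Mu; have := hphi f (FM f fF); lra.
Qed.

End Process.

(** * Sums of totally bounded sets *)

Section TotallyBoundedSum.
Context d (X : measurableType d) (R : realType) (mu : probability X R).
Context (W : zmodType) (I : finType) (c : W -> X -> I).
Hypothesis mc : forall w, fin_var (c w).
Hypothesis dist_add : forall r u v, dist mu c (u + r) (v + r) = dist mu c u v.

(** Sums of the two nets form a net, as invariance gives
    d(m + n, f + g) <= d(m, f) + d(n, g). *)
Lemma totally_bounded_add (M N P : set W) :
  totally_bounded mu c M -> totally_bounded mu c N ->
  (forall u, P u -> exists m n, [/\ M m, N n & u = m + n]) ->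
  totally_bounded mu c P.
Proof.
move=> tM tN hP e e0; have e20 : 0 < e / 2 by lra.
have [F hF] := tM _ e20; have [G hG] := tN _ e20.
exists [seq f + g | f <- F, g <- G] => u /hP [m [n [Mm Nn ->]]].
have [f fF df] := hF m Mm; have [g gG dg] := hG n Nn.
exists (f + g); first by apply/allpairsP; exists (f, g).
have := dist_triangle mu mc (f + n) (m + n) (f + g).
by rewrite dist_add 2![f + _]addrC dist_add; lra.
Qed.

End TotallyBoundedSum.

(** * Bounds on the limit superior *)

Section Limsup.
Context {R : realType}.
Implicit Types (u : nat -> \bar R) (e : \bar R).

Lemma limn_esup_le u e : (exists K, forall k, (K <= k)%N -> (u k <= e)%E) ->
  (limn_esup u <= e)%E.
Proof.
move=> [K hK]; apply: (@le_trans _ _ (ereal_sup (u @` [set k | (K <= k)%N]))).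
  by apply: ereal_inf_lbound; exists [set k | (K <= k)%N] => //; exists K.
by apply: ge_ereal_sup => _ [k Kk <-]; apply: hK.
Qed.

Lemma limn_esup_ge u e : (forall k, (0 < k)%N -> (e <= u k)%E) ->
  (e <= limn_esup u)%E.
Proof.
move=> h; apply: le_ereal_inf_tmp => _ [A [K _ KA] <-].
apply: (le_trans (h K.+1 isT)); apply: ereal_sup_ubound.
by exists K.+1 => //; apply: KA => /=.
Qed.

End Limsup.

(** * Lattice points near a line *)

Section Directions.
Context {R : realType} {p : nat}.
Implicit Types (v : 'rV[R]_p.+1) (b : 'rV[R]_p).

(** Return times of the rotation of the torus by (beta_2, ..., beta_q) to a
    neighbourhood of 0 have bounded gaps. Cut the torus into boxes with sides at
    most b_i / 2. If n and f have their multiples of beta in the same box, then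
    n - f is the first coordinate of a point of Lambda; taking f among finitely
    many representatives of the boxes keeps n - f at bounded distance from n,
    the integer part of t. *)
Lemma Lambda_relatively_dense v b : is_direction v ->
  (forall i, 0 < b ord0 i) ->
  exists C : R, forall t : R, exists2 m, Lambda v b m &
    forall j, `|(m ord0 j)%:~R - t * v ord0 j| <= C.
Proof.
move=> v1 b0.
pose beta i := v ord0 (lift ord0 i).
pose fl (n : int) i := Num.floor (n%:~R * beta i).
pose fr (n : int) i := n%:~R * beta i - (fl n i)%:~R.
have fr_itv n i : 0 <= fr n i < 1.
  have := floor_itv (n%:~R * beta i); rewrite intrD /fr /fl; lra.
pose N := (\max_(i < p) (Num.truncn (2 / b ord0 i)).+1)%N.
have hN i : 2 <= N%:R * b ord0 i.
  rewrite -ler_pdivrMr //; apply: ltW; apply: (lt_le_trans (truncnS_gt _)).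
  rewrite ler_nat.
  exact: (@leq_bigmax _ (fun i => (Num.truncn (2 / b ord0 i)).+1)).
(* The box of the fractional parts of n * beta; 1 / N bounds its sides. *)
pose box (n : int) : {ffun 'I_p -> 'I_N.+1} :=
  [ffun i => inord (Num.truncn (N%:R * fr n i))].
have boxE n i : (box n i)%:R <= N%:R * fr n i < (box n i)%:R + 1.
  have /andP[f0 f1] := fr_itv n i.
  have h0 : 0 <= N%:R * fr n i by rewrite mulr_ge0.
  rewrite ffunE inordK; first by have := truncn_itv h0; rewrite -natr1.
  rewrite ltnS -(ler_nat R); have /andP[h1 _] := truncn_itv h0.
  by apply: (le_trans h1); rewrite ler_piMr // ltW.
have close n n' i : box n = box n' -> `|fr n i - fr n' i| <= b ord0 i / 2.
  move=> E; have := boxE n i; have := boxE n' i; rewrite E => {E} h h'.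
  have := hN i; have bi := b0 i.
  have : `|N%:R * (fr n i - fr n' i)| <= 1 by rewrite ler_norml mulrBr; lra.
  rewrite normrM ger0_norm //; have := normr_ge0 (fr n i - fr n' i).
  move=> x0 h1 h2; have N0 : 0 < N%:R :> R by rewrite ltNge; apply/negP => N0; nra.
  rewrite -(ler_pM2l N0); lra.
have [F _ hF] := color_representatives setT box.
pose C0 : R := 1 + \sum_(f <- F) `|f%:~R|.
have C00 : 0 <= C0 by rewrite addr_ge0 // sumr_ge0.
exists (1 + (1 + \sum_j `|v ord0 j|) * C0) => t.
pose n := Num.floor t.
have [f fF bf] := hF n Logic.I.
pose m : 'rV[int]_p.+1 := \row_j
  if unlift ord0 j is Some i then fl n i - fl f i else n - f.
have m0 : m ord0 ord0 = n - f by rewrite mxE unlift_none.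
have mS i : (m ord0 (lift ord0 i))%:~R =
    beta i * (m ord0 ord0)%:~R - (fr n i - fr f i).
  by rewrite m0 mxE liftK !intrB /fr; lra.
have m0t : `|(m ord0 ord0)%:~R - t| <= C0.
  rewrite m0 intrB; have := floor_itv t; rewrite -/n intrD => ht.
  have : `|f%:~R| <= \sum_(f <- F) `|f%:~R : R|.
    by rewrite (big_rem f) //= lerDl sumr_ge0.
  by rewrite /C0 !ler_norml; lra.
exists m => [i|j].
  have := close _ _ i (esym bf); rewrite mS -/(beta i) ler_norml; lra.
have vj : `|v ord0 j| <= \sum_j `|v ord0 j|.
  by rewrite (bigD1 j) //= lerDl sumr_ge0.
have : `|v ord0 j * ((m ord0 ord0)%:~R - t)| <= `|v ord0 j| * C0.
  by rewrite normrM ler_wpM2l.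
suff : `|(m ord0 j)%:~R - v ord0 j * (m ord0 ord0)%:~R| <= 1.
  have := normr_ge0 (v ord0 j); rewrite !ler_norml; nra.
case: (unliftP ord0 j) => [i ->|->].
  rewrite mS -/(beta i); have := fr_itv n i; have := fr_itv f i.
  by rewrite ler_norml; lra.
by rewrite v1 mul1r subrr normr0.
Qed.

Lemma bounded_lattice_points (C : R) : exists F : seq 'rV[int]_p.+1,
  forall u : 'rV[int]_p.+1, (forall j, `|(u ord0 j)%:~R| <= C) -> u \in F.
Proof.
pose N := Num.truncn C.
exists [seq \row_j ((val (f j) : nat)%:Z - N%:Z) |
  f : {ffun 'I_p.+1 -> 'I_(N + N).+1}].
move=> u hu; apply/codomP.
exists [ffun j => inord (absz (u ord0 j + N%:Z))]; apply/rowP => j.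
have uN : (absz (u ord0 j) <= N)%N.
  rewrite truncn_ge_nat ?(le_trans _ (hu j)) //.
  by rewrite pmulrn abszE intr_norm.
rewrite mxE ffunE /= -[LHS]/(u ord0 j).
by rewrite inordK; lia.
Qed.

End Directions.

(** * Dynamical systems *)

Section System.
Context (R : realType) (p : nat) (X : pointedMetricType R).
Context (mu : probability (borel X) R) (T : 'rV[int]_p.+1 -> X -> X).
Hypothesis hT : is_Zq_mps mu T.
Context (I : finType) (code : borel X -> I).
Hypothesis mcode : fin_var code.

(** The map code names the cell of each point, so the fibers of orbit_code w are
    the cells of T^{-w} alpha. *)
Definition orbit_code (w : 'rV[int]_p.+1) : borel X -> I :=
  fun x => code (T w x).

Local Notation c := orbit_code.

Lemma measurable_translate w (A : set (borel X)) :
  measurable A -> measurable (T w @^-1` A : set (borel X)).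
Proof.
move=> mA; have [cT _] := mps_homeo hT w.
have mT : measurable_fun [set: borel X] (T w : borel X -> borel X).
  apply: (@measurability _ _ (borel X) (borel X) _ _ (@open X)) => // _ [B oB <-].
  by rewrite setTI; apply: sub_sigma_algebra; apply: open_comp => // x _; apply: cT.
by rewrite -[_ @^-1` _]setTI; apply: mT.
Qed.

Lemma fin_var_translate w : fin_var (c w).
Proof. by move=> i; apply: (measurable_translate w (mcode i)). Qed.

Lemma dist_translate r u v :
  dist mu c (u + r) (v + r) = dist mu c u v.
Proof.
rewrite /dist /pr; congr fine.
rewrite -[RHS](mps_invariant hT r) //; last first.
  exact: (measurable_neq (fin_var_translate u) (fin_var_translate v)).
by congr (mu _); apply/funext => x; rewrite /= /orbit_code -!(mps_comp hT).
Qed.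

Lemma seq_entropyE w : seq_entropy mu T (fun i => code @^-1` [set i]) w =
  limn_esup (fun k => (k%:R^-1 * ent mu (history c w k))%:E).
Proof.
congr limn_esup; apply/funext => k; congr (_ * _)%:E.
congr (entropy mu); apply/funext => f; apply/seteqP; split => x /=.
  by move=> h; apply/ffunP => j; rewrite ffunE; apply: h.
by move=> <- j _ /=; rewrite ffunE.
Qed.

(** If no finite history predicts Lambda up to e, the greedy sequence in Lambda
    has entropy at least e. *)
Lemma dir_entropy0_totally_bounded b v (i0 : I) :
  dir_entropy mu T (fun i => code @^-1` [set i]) b v = 0%E ->
  totally_bounded mu c (Lambda v b).
Proof.
move=> h0; apply: (predictable_totally_bounded fin_var_translate i0) => e e0.
apply: contrapT => npred.
have [|w wM we] := @greedy_sequence _ _ _ mu _ _ c 0 (Lambda v b) e.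
  move=> w k _; apply: contrapT => nu; apply: npred; exists w, k => u Mu.
  by rewrite ltNge; apply/negP => eu; apply: nu; exists u.
have winj := innovating_inj fin_var_translate e0 we.
have : (e%:E <= dir_entropy mu T (fun i => code @^-1` [set i]) b v)%E.
  apply: (@le_trans _ _ (seq_entropy mu T (fun i => code @^-1` [set i]) w)).
    rewrite seq_entropyE; apply: limn_esup_ge => k k0; rewrite lee_fin.
    exact: (innovating_entropy fin_var_translate we k0).
  apply: ereal_sup_ubound; exists w => //; split=> // _ [k _ <-]; exact: wM.
by rewrite h0 lee_fin leNgt e0.
Qed.

(** Induction on vs. If u is within C of t v + s', a point m of Lambda v b within
    D of t v leaves u - m within C + D of s'. This is why the bound C is
    arbitrary in the statement. *)
Lemma near_span_totally_bounded (b : 'rV[R]_p) (vs : seq 'rV[R]_p.+1) :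
  (forall i, 0 < b ord0 i) ->
  (forall v, v \in vs -> is_direction v /\
     totally_bounded mu c (Lambda v b)) ->
  forall C : R, totally_bounded mu c
    [set u : 'rV[int]_p.+1 | exists2 s, s \in <<vs>>%VS &
      forall j, `|(u ord0 j)%:~R - s ord0 j| <= C].
Proof.
move=> b0; elim: vs => [_|v vs IH hvs] C.
  have [F hF] := @bounded_lattice_points R p C.
  apply: (totally_bounded_finite mu c (F := F)) => u [s].
  rewrite span_nil memv0 => /eqP -> h; apply: hF => j.
  by have := h j; rewrite mxE subr0.
have [v1 tv] := hvs v (mem_head _ _).
have [D hD] := Lambda_relatively_dense v1 b0.
have IHD : forall C, _ := IH (fun u uvs => hvs u (@mem_behead _ (v :: vs) u uvs)).
apply: (totally_bounded_add fin_var_translate dist_translate tv (IHD (C + D))).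
move=> u [s].
rewrite span_cons => /memv_addP [_ /vlineP [t ->] [s' s's ->]] hs.
have [m mL hm] := hD t; exists m, (u - m); split=> //; last by rewrite addrC subrK.
exists s' => // j; have := hs j; have := hm j; rewrite !mxE intrB !ler_norml; lra.
Qed.

(** Total boundedness makes every sequence recurrent for the pseudometric, and
    recurrence makes the entropy rate at most e for every e > 0. *)
Lemma totally_bounded_seq_entropy w :
  totally_bounded mu c setT ->
  (seq_entropy mu T (fun i => code @^-1` [set i]) w <= 0)%E.
Proof.
move=> tb; apply/lee_addgt0Pr => e e0; rewrite add0e seq_entropyE.
have rec := totally_bounded_recurrent fin_var_translate w tb.
have [K hK] := recurrent_entropy_rate fin_var_translate rec e0.
by apply: limn_esup_le; exists K => k /hK; rewrite lee_fin.
Qed.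

End System.

(** * Linear independence and conclusion *)

Lemma partition_code d (X : measurableType d) (I : finType) (alpha : I -> set X) :
  measurable_partition alpha ->
  exists2 code : X -> I, fin_var code & alpha = fun i => code @^-1` [set i].
Proof.
move=> [ma da ca].
have /choice [code hcode] : forall x, exists i, alpha i x.
  move=> x; have : (\bigcup_i alpha i) x by rewrite ca.
  by case=> i _; exists i.
have E : alpha = fun i => code @^-1` [set i].
  apply/funext => i; apply/seteqP; split => x /= => [ax|<- //].
  by apply: (da) => //; exists x.
by exists code => // i; have := ma i; rewrite E.
Qed.

Lemma span_full (K : fieldType) (V : vectType K) (vs : seq V) :
  free vs -> (dim V <= size vs)%N -> <<vs>>%VS = fullv.
Proof.
by move=> fr sz; apply/eqP; rewrite eqEdim subvf dimvf (eqP fr).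
Qed.

Theorem theoremB5 (R : realType) (p : nat) (hq : (2 <= p.+1)%N)
    (X : pointedMetricType R) (mu : probability (borel X) R)
    (T : 'rV[int]_p.+1 -> X -> X) (hT : is_Zq_mps mu T)
    (I : finType) (alpha : I -> set (borel X))
    (halpha : measurable_partition alpha)
    (hS : exists2 w : nat -> 'rV[int]_p.+1,
            injective w & (0 < seq_entropy mu T alpha w)%E)
    (b : 'rV[R]_p) (hb : forall i, 0 < b ord0 i)
    (vs : seq 'rV[R]_p.+1) (hfree : free vs)
    (hvs : forall v, v \in vs ->
             is_direction v /\ dir_entropy mu T alpha b v = 0%E) :
  (size vs <= p)%N.
Proof.
have [code mcode E] := partition_code halpha.
rewrite {alpha halpha}E in hS hvs.
have [w _ hw] := hS.
rewrite leqNgt; apply/negP => szvs.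
have full : <<vs>>%VS = fullv.
  by apply: span_full => //; rewrite dim_matrix mul1r.
suff tb : totally_bounded mu (orbit_code T code) setT.
  by have := totally_bounded_seq_entropy hT mcode w tb; rewrite leNgt hw.
have tb := near_span_totally_bounded hT mcode hb
  (fun v vvs => conj (hvs v vvs).1
     (dir_entropy0_totally_bounded hT mcode (code point) (hvs v vvs).2)) 0.
move=> e /tb [F hF]; exists F => u _; apply: hF.
exists (\row_j (u ord0 j)%:~R) => [|j]; first by rewrite full memvf.
by rewrite mxE subrr normr0.
Qed.
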